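(* Let $(\mathfrak g,\mathfrak s,V)$ be a complex generic kinematical Lie algebra ($\mathbb K=\mathbb C$), with decomposition $\mathfrak g=\mathcal Z\oplus\mathfrak s\oplus\mathcal P$, whose associated symmetric space is indecomposable and non-flat. Then the action (by $\mathrm{ad}$) of the complex line $\mathcal Z$ on $\mathcal P$ is either nilpotent or semisimple. Moreover, when nilpotent, the action of $\mathcal Z$ on $\mathcal P$ squares to zero, i.e. $(\mathrm{ad}_{Z}|_{\mathcal P})^2=0$ for $Z\in\mathcal Z$.
   Context: An $\mathfrak s$-module $M$ over $\mathbb K$ is absolutely simple if it is simple and the only $\mathbb K$-endomorphisms of $M$ commuting with $\mathfrak s$ are the scalars. For an $\mathfrak s$-module $W$ and an irreducible $\mathfrak s$-module $L$, the weak isotypical component of $L$ in $W$ is the vector sum of all submodules of $W$ isomorphic to $L$; ''empty'' means it is $\{0\}$. A generic kinematical Lie algebra over $\mathbb K$ is a triple $(\mathfrak g,\mathfrak s,V)$ where $\mathfrak g$ is a finite-dimensional Lie algebra over $\mathbb K$; $\mathfrak s$ is a Lie subalgebra of $\mathfrak g$; $V$ is a faithful absolutely simple finite-dimensional $\mathfrak s$-module over $\mathbb K$ such that the weak isotypical component of $V$ in $\Lambda^2(V)$ is empty and the $\mathfrak s$-action preserves a non-degenerate scalar product on $V$ (not necessarily positive definite); and $\mathfrak g=\mathcal Z\oplus\mathfrak s\oplus\mathcal P$ as a vector space, with $\mathcal P$ an $\mathfrak s$-stable subspace isomorphic to $V\oplus V$ as $\mathfrak s$-module, and $\mathcal Z$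 a line centralizing $\mathfrak s$ in $\mathfrak g$. Then $\sigma:=\mathrm{id}_{\mathcal Z\oplus\mathfrak s}\oplus(-\mathrm{id}_{\mathcal P})$ is an involutive automorphism of $\mathfrak g$ (the associated involutive Lie algebra, iLa, is $(\mathfrak g,\sigma)$); in particular $[\mathcal Z,\mathcal P]\subset\mathcal P$. The symmetric space associated with an iLa $(\mathfrak g,\sigma)$, $\mathfrak g=\mathfrak h\oplus\mathcal P$ ($\pm1$-eigenspaces), is the simply connected symmetric space $G/H$ with $G$ the connected simply connected Lie group with Lie algebra $\mathfrak g$ and $H$ the identity component of the fixed group of the automorphism of $G$ integrating $\sigma$. It is flat if and only if $[\mathcal P,\mathcal P]$ centralizes $\mathcal P$. It is decomposable if it is isomorphic to a product of two non-trivial symmetric spaces; equivalently its transvection iLa (the iLa induced on $([\mathcal P,\mathcal P]\oplus\mathcal P)/\mathfrak n$, with $\mathfrak n$ the centralizer of $\mathcal P$ in $[\mathcal P,\mathcal P]$) is isomorphic to a direct sum of two non-trivial iLa's. Indecomposable means not decomposable. *)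

(* Defs.v *)
From HB Require Import structures.
From mathcomp Require Import all_boot all_algebra.

Set Implicit Arguments.
Unset Strict Implicit.
Unset Printing Implicit Defensive.

Import GRing.Theory.
Local Open Scope ring_scope.

HB.mixin Record Vector_isLieAlgebra (K : fieldType) L of Vector K L := {
  lie : L -> L -> L;
  lie_linear_l : forall y, linear (fun x => lie x y);
  lie_linear_r : forall x, linear (fun y => lie x y);
  liexx : forall x, lie x x = 0;
  lie_jacobi : forall x y z,
    lie x (lie y z) + lie y (lie z x) + lie z (lie x y) = 0
}.

#[short(type="lieAlgType")]
HB.structure Definition LieAlgebra (K : fieldType) :=
  {L of Vector K L & Vector_isLieAlgebra K L}.

Notation "[ 'lie' x , y ]" := (lie x y)
  (at level 0, x, y at level 99, format "[ 'lie'  x ,  y ]") : ring_scope.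

Section LieTheory.
Context {K : fieldType} {L : lieAlgType K}.
Implicit Types (x y z : L) (U W : {vspace L}).

HB.instance Definition _ x :=
  GRing.isLinear.Build K L L _ (lie x) (lie_linear_r x).

Definition ad x : 'End(L) := linfun (lie x).

Lemma adE x y : ad x y = [lie x, y].
Proof. by rewrite lfunE. Qed.

Lemma lieDl x y z : [lie x + y, z] = [lie x, z] + [lie y, z].
Proof. by have := lie_linear_l z 1 x y; rewrite !scale1r. Qed.

Lemma lieDr x y z : [lie x, y + z] = [lie x, y] + [lie x, z].
Proof. exact: linearD. Qed.

Lemma lie0l y : [lie 0, y] = 0.
Proof. by apply: (addrI [lie 0, y]); rewrite -lieDl !addr0. Qed.

Lemma lie0r y : [lie y, 0] = 0.
Proof. exact: linear0. Qed.

Lemma lieZl a x y : [lie a *: x, y] = a *: [lie x, y].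
Proof. by have := lie_linear_l y a x 0; rewrite !addr0 lie0l addr0. Qed.

Lemma lieC x y : [lie x, y] = - [lie y, x].
Proof.
apply/eqP; rewrite -addr_eq0.
by have := liexx (x + y); rewrite lieDl !lieDr !liexx add0r addr0 => ->.
Qed.

Lemma lieNr x y : [lie x, - y] = - [lie x, y].
Proof. exact: linearN. Qed.

Lemma lieNl x y : [lie - x, y] = - [lie x, y].
Proof. by rewrite lieC lieNr -lieC. Qed.

Lemma lie_leibniz x y z :
  [lie x, [lie y, z]] = [lie [lie x, y], z] + [lie y, [lie x, z]].
Proof.
have /eqP := lie_jacobi x y z; rewrite -addrA addr_eq0 => /eqP ->.
by rewrite [[lie z, [lie x, y]]]lieC [[lie z, x]]lieC linearN opprD !opprK addrC.
Qed.

Definition lie_vs U W : {vspace L} :=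
  <<[seq [lie u, w] | u <- vbasis U, w <- vbasis W]>>%VS.

Lemma mem_lie_vs U W x y : x \in U -> y \in W -> [lie x, y] \in lie_vs U W.
Proof.
move=> /coord_vbasis -> /coord_vbasis ->; rewrite lieC linear_sum rpredN.
apply: rpred_sum => i _; rewrite linearZ /= rpredZ // lieC linear_sum rpredN.
apply: rpred_sum => j _; rewrite linearZ /= rpredZ //.
by apply: memv_span; apply: allpairs_f; apply: memt_nth.
Qed.

Lemma lie_vs_sub U W (X : {vspace L}) :
  {in U & W, forall x y, [lie x, y] \in X} -> (lie_vs U W <= X)%VS.
Proof.
move=> UWX; apply/span_subvP => _ /allpairsP[[u w] /= [uU wW ->]].
by apply: UWX; apply: vbasis_mem.
Qed.

Definition centralizer U : {vspace L} :=
  (\bigcap_(i < \dim U) lker (ad (vbasis U)`_i))%VS.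

Lemma centralizerP U x :
  reflect {in U, forall u, [lie x, u] = 0} (x \in centralizer U).
Proof.
rewrite memvE; apply: (iffP subv_bigcapP) => [cx u /coord_vbasis -> | cx i _].
  rewrite linear_sum big1 // => i _; rewrite linearZ /= lieC.
  have := cx i isT; rewrite -memvE memv_ker adE => /eqP ->.
  by rewrite oppr0 scaler0.
rewrite -memvE memv_ker adE lieC cx ?oppr0 //.
by apply: vbasis_mem; apply: memt_nth.
Qed.

End LieTheory.

Record lieSub (K : fieldType) (L : lieAlgType K) := LieSub {
  lieSub_vs :> {vspace L};
  lieSubP : {in lieSub_vs &, forall x y, [lie x, y] \in lieSub_vs}
}.

Section SubLieAlgebra.
Context {K : fieldType} {L : lieAlgType K} (s : lieSub L).
Implicit Types x y z : subvs_of s.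

Definition sub_lie x y : subvs_of s := vsproj s [lie vsval x, vsval y].

Lemma vsval_sub_lie x y : vsval (sub_lie x y) = [lie vsval x, vsval y].
Proof. by rewrite vsprojK // lieSubP ?subvsP. Qed.

Fact sub_lie_linear_l y : linear (fun x => sub_lie x y).
Proof. move=> a u v; apply/val_inj.
by rewrite linearP /= !vsval_sub_lie linearP /= lieDl lieZl. Qed.

Fact sub_lie_linear_r x : linear (fun y => sub_lie x y).
Proof. move=> a u v; apply/val_inj.
by rewrite linearP /= !vsval_sub_lie !linearP. Qed.

Fact sub_liexx x : sub_lie x x = 0.
Proof. by rewrite /sub_lie liexx linear0. Qed.

Fact sub_lie_jacobi x y z :
  sub_lie x (sub_lie y z) + sub_lie y (sub_lie z x) + sub_lie z (sub_lie x y)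
  = 0.
Proof.
by apply/val_inj; rewrite !linearD /= !vsval_sub_lie lie_jacobi.
Qed.

HB.instance Definition _ := Vector_isLieAlgebra.Build K (subvs_of s)
  sub_lie_linear_l sub_lie_linear_r sub_liexx sub_lie_jacobi.

End SubLieAlgebra.

Section ProdLieAlgebra.
Context {K : fieldType} {L1 L2 : lieAlgType K}.
Implicit Types x y z : (L1 * L2)%type.

Definition prod_lie x y : (L1 * L2)%type := ([lie x.1, y.1], [lie x.2, y.2]).

Fact prod_lie_linear_l y : linear (fun x => prod_lie x y).
Proof. by move=> a u v; congr (_, _); rewrite /= lieDl lieZl. Qed.

Fact prod_lie_linear_r x : linear (fun y => prod_lie x y).
Proof. by move=> a u v; congr (_, _); rewrite /= linearP. Qed.

Fact prod_liexx x : prod_lie x x = 0.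
Proof. by rewrite /prod_lie !liexx. Qed.

Fact prod_lie_jacobi x y z :
  prod_lie x (prod_lie y z) + prod_lie y (prod_lie z x)
  + prod_lie z (prod_lie x y) = 0.
Proof. by congr (_, _); apply: lie_jacobi. Qed.

HB.instance Definition _ := Vector_isLieAlgebra.Build K (L1 * L2)%type
  prod_lie_linear_l prod_lie_linear_r prod_liexx prod_lie_jacobi.

End ProdLieAlgebra.

Record involution (K : fieldType) (L : lieAlgType K) := Involution {
  invol_fun :> 'End(L);
  involK : involutive invol_fun;
  invol_lie : forall x y,
    invol_fun [lie x, y] = [lie invol_fun x, invol_fun y]
}.

Section Transvection.
Context {K : fieldType} {L : lieAlgType K} (sigma : involution L).

(* Meaningful in characteristic different from 2. *)
Definition minus_part : {vspace L} := passmx.leigenspace sigma (- 1).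

Local Notation P := minus_part.
Local Notation PP := (lie_vs P P).

(* Flatness of the associated symmetric space. *)
Definition flat : Prop := (PP <= centralizer P)%VS.

Definition transv_vs : {vspace L} := (PP + P)%VS.
Definition transv_ker : {vspace L} := (PP :&: centralizer P)%VS.

(* The quotient [transv_vs / transv_ker], realized on a linear complement of
   [transv_ker]; [transv_proj] is the canonical projection, see
   [transv_proj_surj], [transv_proj_ker], [transv_proj_lie] and
   [transv_proj_invol] below. *)
Definition transv := subvs_of (transv_vs :\: transv_ker).
HB.instance Definition _ := Vector.on transv.

Definition transv_proj : 'Hom(L, transv) :=
  linfun (vsproj (transv_vs :\: transv_ker) \o addv_pi1 transv_vs transv_ker).

Lemma minus_partP x : reflect (sigma x = - x) (x \in P).
Proof.
rewrite memv_ker add_lfunE opp_lfunE scale_lfunE id_lfunE scaleN1r opprK.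
by rewrite addr_eq0; apply: eqP.
Qed.

Lemma invol_PP d : d \in PP -> sigma d = d.
Proof.
suff /subvP h : (PP <= fixedSpace sigma)%VS by move/h/fixedSpaceP.
apply: lie_vs_sub => x y /minus_partP xP /minus_partP yP; apply/fixedSpaceP.
by rewrite invol_lie xP yP lieNl lieNr opprK.
Qed.

Lemma lie_PP_P d x : d \in PP -> x \in P -> [lie d, x] \in P.
Proof.
move=> /invol_PP dP /minus_partP xP; apply/minus_partP.
by rewrite invol_lie dP xP linearN.
Qed.

Lemma lie_PP_PP d e : d \in PP -> e \in PP -> [lie d, e] \in PP.
Proof.
move=> dP eP.
suff /subvP/(_ e eP) : (PP <= ad d @^-1: PP)%VS by rewrite -memv_preim adE.
apply: lie_vs_sub => x y xP yP; rewrite -memv_preim adE lie_leibniz.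
by rewrite rpredD // mem_lie_vs // lie_PP_P.
Qed.

Lemma PP_sub_transv : (PP <= transv_vs)%VS.
Proof. exact: addvSl. Qed.

Lemma minus_sub_transv : (P <= transv_vs)%VS.
Proof. exact: addvSr. Qed.

Lemma transv_lie x y :
  x \in transv_vs -> y \in transv_vs -> [lie x, y] \in transv_vs.
Proof.
move=> /memv_addP[d dP [p pP ->]] /memv_addP[e eP [q qP ->]].
rewrite lieDl !lieDr; apply: rpredD; apply: rpredD.
- exact/(subvP PP_sub_transv)/lie_PP_PP.
- exact/(subvP minus_sub_transv)/lie_PP_P.
- by rewrite lieC rpredN; apply/(subvP minus_sub_transv)/lie_PP_P.
- exact/(subvP PP_sub_transv)/mem_lie_vs.
Qed.

Lemma transv_invol x : x \in transv_vs -> sigma x \in transv_vs.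
Proof.
move=> /memv_addP[d dP [p pP ->]]; rewrite linearD /= invol_PP //.
rewrite ((minus_partP _) pP) rpredB //.
  exact: (subvP PP_sub_transv).
exact: (subvP minus_sub_transv).
Qed.

Lemma transv_ker_sub : (transv_ker <= transv_vs)%VS.
Proof. exact: subv_trans (capvSl _ _) PP_sub_transv. Qed.

Lemma transv_ker_lie x k :
  x \in transv_vs -> k \in transv_ker -> [lie x, k] \in transv_ker.
Proof.
move=> /memv_addP[d dP [p pP ->]]; rewrite memv_cap => /andP[kP ck].
have /centralizerP ckP := ck.
rewrite lieDl rpredD // memv_cap.
  rewrite lie_PP_PP //=; apply/centralizerP => q qP.
  have kq : [lie q, k] = 0 by rewrite lieC ckP ?oppr0.
  rewrite lieC lie_leibniz kq lie0r addr0 lieC opprK ckP //.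
  by rewrite lieC rpredN lie_PP_P.
by rewrite lieC ckP // oppr0 !mem0v.
Qed.

Lemma vsval_transv_proj x :
  vsval (transv_proj x) = addv_pi1 transv_vs transv_ker x.
Proof. by rewrite lfunE /= vsprojK // memv_pi. Qed.

Lemma transv_projB x :
  x \in transv_vs -> x - vsval (transv_proj x) \in transv_ker.
Proof.
move=> xh; rewrite vsval_transv_proj -{1}(@addv_pi1_pi2 _ _ transv_vs transv_ker x).
  by rewrite addrC addKr memv_pi2.
exact: (subvP (addvSl _ _)).
Qed.

Lemma transv_val_mem (u : transv) : vsval u \in transv_vs.
Proof. exact/(subvP (diffvSl _ _))/subvsP. Qed.

Lemma transv_projK (u : transv) : transv_proj (vsval u) = u.
Proof.
apply: val_inj; rewrite /= vsval_transv_proj daddv_pi_id ?subvsP //.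
exact: capv_diff.
Qed.

Lemma transv_proj0 k : k \in transv_ker -> transv_proj k = 0.
Proof.
move=> kn; apply: val_inj; rewrite /= vsval_transv_proj.
apply: (addIr (addv_pi2 transv_vs transv_ker k)).
rewrite addv_pi1_pi2; last exact: (subvP (addvSr _ _)).
by rewrite addv_pi2_id // add0r.
Qed.

Lemma transv_proj_surj (u : transv) :
  exists2 x, x \in transv_vs & transv_proj x = u.
Proof. by exists (vsval u); [exact: transv_val_mem | exact: transv_projK]. Qed.

Lemma transv_proj_ker x :
  x \in transv_vs -> (transv_proj x == 0) = (x \in transv_ker).
Proof.
move=> xh; apply/eqP/idP => [x0|]; last exact: transv_proj0.
by have := transv_projB xh; rewrite x0 /= subr0.
Qed.

Definition transv_br (u v : transv) : transv :=
  transv_proj [lie vsval u, vsval v].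

Lemma transv_proj_lier x y : x \in transv_vs -> y \in transv_vs ->
  transv_proj [lie x, vsval (transv_proj y)] = transv_proj [lie x, y].
Proof.
move=> xh yh; apply/eqP; rewrite eq_sym -subr_eq0 -linearB -linearB /=.
by apply/eqP/transv_proj0/transv_ker_lie => //; apply: transv_projB.
Qed.

Lemma transv_proj_lie x y : x \in transv_vs -> y \in transv_vs ->
  transv_proj [lie x, y] = transv_br (transv_proj x) (transv_proj y).
Proof.
move=> xh yh; rewrite /transv_br transv_proj_lier ?transv_val_mem //.
by rewrite lieC (lieC _ y) !linearN /= transv_proj_lier.
Qed.

Fact transv_linear_l v : linear (fun u => transv_br u v).
Proof. by move=> a x y; rewrite /transv_br /= lieDl lieZl linearP. Qed.

Fact transv_linear_r u : linear (fun v => transv_br u v).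
Proof. by move=> a x y; rewrite /transv_br !linearP. Qed.

Fact transv_liexx u : transv_br u u = 0.
Proof. by rewrite /transv_br liexx linear0. Qed.

Fact transv_jacobi u v w :
  transv_br u (transv_br v w) + transv_br v (transv_br w u)
  + transv_br w (transv_br u v) = 0.
Proof.
rewrite /transv_br !transv_proj_lier ?transv_lie ?transv_val_mem //.
by rewrite -!linearD lie_jacobi linear0.
Qed.

HB.instance Definition _ := Vector_isLieAlgebra.Build K transv
  transv_linear_l transv_linear_r transv_liexx transv_jacobi.

Definition transv_sigma : 'End(transv) :=
  linfun (transv_proj \o sigma \o vsval).

Lemma transv_ker_invol k : k \in transv_ker -> sigma k \in transv_ker.
Proof. by move=> kn; move: (kn); rewrite memv_cap => /andP[/invol_PP -> _]. Qed.

Lemma transv_proj_invol x : x \in transv_vs ->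
  transv_proj (sigma x) = transv_sigma (transv_proj x).
Proof.
move=> xh; apply/eqP; rewrite [transv_sigma _]lfunE /= -subr_eq0 -!linearB /=.
by apply/eqP/transv_proj0/transv_ker_invol/transv_projB.
Qed.

Fact transv_sigmaK : involutive transv_sigma.
Proof.
move=> u; have [x xh <-] := transv_proj_surj u.
by rewrite -!transv_proj_invol ?transv_invol ?involK.
Qed.

Fact transv_sigma_lie (u v : transv) :
  transv_sigma [lie u, v] = [lie transv_sigma u, transv_sigma v].
Proof.
have [x xh <-] := transv_proj_surj u; have [y yh <-] := transv_proj_surj v.
have lieE p q : p \in transv_vs -> q \in transv_vs ->
    [lie transv_proj p, transv_proj q] = transv_proj [lie p, q].
  by move=> ph qh; rewrite transv_proj_lie.
rewrite lieE // -!transv_proj_invol ?transv_lie // lieE ?transv_invol //.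
by rewrite invol_lie.
Qed.

Definition transv_involution : involution transv :=
  Involution transv_sigmaK transv_sigma_lie.

End Transvection.

Section Decomposable.
Context {K : fieldType}.

Definition ila_isom (L1 L2 : lieAlgType K)
    (sigma1 : L1 -> L1) (sigma2 : L2 -> L2) : Prop :=
  exists f : 'Hom(L1, L2),
    [/\ bijective f,
        forall x y, f [lie x, y] = [lie f x, f y]
      & forall x, f (sigma1 x) = sigma2 (f x)].

Definition prod_sigma (L1 L2 : lieAlgType K)
    (sigma1 : involution L1) (sigma2 : involution L2)
    (x : (L1 * L2)%type) : (L1 * L2)%type :=
  (sigma1 x.1, sigma2 x.2).

(* Decomposability is that of the associated simply connected symmetric space,
   which is determined by the transvection algebra. A direct factor of a
   transvection algebra is nonzero if and only if its (-1)-eigenspace is. *)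
Definition decomposable (L : lieAlgType K) (sigma : involution L) : Prop :=
  exists (L1 L2 : lieAlgType K)
         (sigma1 : involution L1) (sigma2 : involution L2),
    [/\ (exists x : L1, x != 0), (exists x : L2, x != 0)
      & ila_isom (transv_involution sigma) (prod_sigma sigma1 sigma2)].

Definition indecomposable (L : lieAlgType K) (sigma : involution L) : Prop :=
  ~ decomposable sigma.

End Decomposable.

Section Modules.
Context {K : fieldType} {S : lieAlgType K}.

Definition is_rep (V : vectType K) (rho : S -> 'End(V)) : Prop :=
  linear rho /\
  forall x y v, rho [lie x, y] v = rho x (rho y v) - rho y (rho x v).

Definition submodule (V : vectType K) (rho : S -> 'End(V)) (U : {vspace V}) :=
  forall x, (rho x @: U <= U)%VS.

Definition simple_rep (V : vectType K) (rho : S -> 'End(V)) : Prop :=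
  (fullv : {vspace V}) != 0%VS /\
  forall U : {vspace V}, submodule rho U -> U = 0%VS \/ U = fullv.

Definition absolutely_simple (V : vectType K) (rho : S -> 'End(V)) : Prop :=
  simple_rep rho /\
  forall f : 'End(V), (forall x v, f (rho x v) = rho x (f v)) ->
    exists c : K, forall v, f v = c *: v.

Definition faithful_rep (V : vectType K) (rho : S -> 'End(V)) : Prop :=
  injective rho.

Definition iso_submodule (V W : vectType K)
    (rhoV : S -> 'End(V)) (rhoW : S -> 'End(W)) (U : {vspace W}) : Prop :=
  submodule rhoW U /\
  exists f : 'Hom(V, W),
    [/\ injective f, limg f = U & forall x v, f (rhoV x v) = rhoW x (f v)].

(* The vector sum of all submodules of [X], itself a submodule of [W], that are
   isomorphic to [V], as a membership predicate. *)
Definition weak_isotypic (V W : vectType K)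
    (rhoV : S -> 'End(V)) (rhoW : S -> 'End(W)) (X : {vspace W}) (w : W) : Prop :=
  exists2 Us : seq {vspace W},
    {in Us, forall U, (U <= X)%VS /\ iso_submodule rhoV rhoW U}
  & w \in (\sum_(U <- Us) U)%VS.

Definition sum_rep (V W : vectType K) (rhoV : S -> 'End(V))
    (rhoW : S -> 'End(W)) (x : S) : 'End((V * W)%type) :=
  linfun (fun p : (V * W)%type => (rhoV x p.1, rhoW x p.2)).

(* [V \otimes V] is realized as ['Hom('Hom(V, K^o), V)], with [u \otimes v] the
   map [alpha |-> alpha u *: v], and [Lambda^2 V] as the span of the
   [u \otimes v - v \otimes u]. *)
Definition tens2 (V : vectType K) : vectType K := 'Hom('Hom(V, K^o), V).

Definition tens (V : vectType K) (u v : V) : tens2 V :=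
  linfun (fun alpha : 'Hom(V, K^o) => (alpha u : K) *: v).

Definition wedge (V : vectType K) (u v : V) : tens2 V := tens u v - tens v u.

Definition exterior2 (V : vectType K) : {vspace tens2 V} :=
  <<[seq wedge u v | u <- vbasis {:V}, v <- vbasis {:V}]>>%VS.

(* [rho x (u \otimes v) = rho x u \otimes v + u \otimes rho x v], see
   [tens2_rep_tens]. *)
Definition tens2_rep (V : vectType K) (rho : S -> 'End(V)) (x : S) :
    'End(tens2 V) :=
  linfun (fun t : tens2 V =>
    linfun (fun alpha : 'Hom(V, K^o) =>
      rho x (t alpha) + t (alpha \o rho x)%VF)).

Lemma sum_repE (V W : vectType K) (rhoV : S -> 'End(V)) (rhoW : S -> 'End(W))
    x p : sum_rep rhoV rhoW x p = (rhoV x p.1, rhoW x p.2).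
Proof.
pose f (p : (V * W)%type) := (rhoV x p.1, rhoW x p.2).
have f_lin : linear f by move=> a u v; congr (_, _); rewrite /= linearP.
pose F := GRing.isLinear.Build _ _ _ _ f f_lin.
exact: (lfunE (HB.pack f F : {linear _ -> _})).
Qed.

Lemma tensE (V : vectType K) (u v : V) (alpha : 'Hom(V, K^o)) :
  tens u v alpha = (alpha u : K) *: v.
Proof.
pose f (alpha : 'Hom(V, K^o)) := (alpha u : K) *: v.
have f_lin : linear f.
  by move=> a b c; rewrite /f add_lfunE scale_lfunE scalerDl scalerA.
pose F := GRing.isLinear.Build _ _ _ _ f f_lin.
exact: (lfunE (HB.pack f F : {linear _ -> _})).
Qed.

Lemma tens2_repE (V : vectType K) (rho : S -> 'End(V)) x t
    (alpha : 'Hom(V, K^o)) :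
  tens2_rep rho x t alpha = rho x (t alpha) + t (alpha \o rho x)%VF.
Proof.
pose f (t : tens2 V) (alpha : 'Hom(V, K^o)) :=
  rho x (t alpha) + t (alpha \o rho x)%VF.
have f_lin u : linear (f u).
  move=> a b c; rewrite /f comp_lfunDl -comp_lfunZl !linearP /=.
  by rewrite scalerDr addrACA.
have fE u b : linfun (f u) b = f u b.
  pose F := GRing.isLinear.Build _ _ _ _ (f u) (f_lin u).
  exact: (lfunE (HB.pack (f u) F : {linear _ -> _})).
pose h u := linfun (f u).
have h_lin : linear h.
  move=> a u v; apply/lfunP => b; rewrite add_lfunE scale_lfunE !fE /f.
  by rewrite !add_lfunE !scale_lfunE linearP /= scalerDr addrACA.
pose H := GRing.isLinear.Build _ _ _ _ h h_lin.
have -> : tens2_rep rho x t = h t.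
  exact: (lfunE (HB.pack h H : {linear _ -> _})).
exact: fE.
Qed.

Lemma tens2_rep_tens (V : vectType K) (rho : S -> 'End(V)) x (u v : V) :
  tens2_rep rho x (tens u v) = tens (rho x u) v + tens u (rho x v).
Proof.
apply/lfunP => alpha; rewrite tens2_repE add_lfunE !tensE comp_lfunE.
by rewrite linearZ addrC.
Qed.

Lemma wedgeC (V : vectType K) (u v : V) : wedge u v = - wedge v u.
Proof. by rewrite opprB. Qed.

Lemma wedge_sumr (V : vectType K) n (c : 'I_n -> K) (e : 'I_n -> V) (u : V) :
  wedge u (\sum_i c i *: e i) = \sum_i c i *: wedge u (e i).
Proof.
apply/lfunP => alpha; rewrite sum_lfunE add_lfunE opp_lfunE !tensE.
rewrite scaler_sumr linear_sum scaler_suml -sumrB; apply: eq_bigr => i _.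
rewrite scale_lfunE add_lfunE opp_lfunE !tensE scalerBr !scalerA linearZ /=.
by rewrite [X in X *: e i]mulrC [alpha (_ *: _)]linearZ scalerN.
Qed.

Lemma mem_wedge (V : vectType K) (u v : V) : wedge u v \in exterior2 V.
Proof.
rewrite (coord_vbasis (memvf u)) (coord_vbasis (memvf v)) wedge_sumr.
apply: rpred_sum => i _; rewrite rpredZ // wedgeC wedge_sumr rpredN.
apply: rpred_sum => j _; rewrite rpredZ // wedgeC rpredN.
by apply: memv_span; apply: allpairs_f; apply: memt_nth.
Qed.

Lemma exterior2_submodule (V : vectType K) (rho : S -> 'End(V)) :
  submodule (tens2_rep rho) (exterior2 V).
Proof.
move=> x; rewrite limg_span; apply/span_subvP => t /mapP[w].
move=> /allpairsP[[u v] [_ _ ->]] -> /=.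
rewrite linearB /= !tens2_rep_tens opprD (addrC (- tens (rho x v) u)) addrACA.
by rewrite rpredD // mem_wedge.
Qed.

Definition invariant_form (V : vectType K) (rho : S -> 'End(V))
    (B : 'Hom(V, 'Hom(V, K^o))) : Prop :=
  forall x u v, B (rho x u) v + B u (rho x v) = 0.

End Modules.

Definition scalar_product (K : fieldType) (V : vectType K)
    (B : 'Hom(V, 'Hom(V, K^o))) : Prop :=
  (forall u v, B u v = B v u) /\ (forall u, (forall v, B u v = 0) -> u = 0).

Definition ad_sub (K : fieldType) (g : lieAlgType K) (s : lieSub g)
  (x : subvs_of s) : 'End(g) := ad (vsval x).

Record generic_kinematical (K : fieldType) (g : lieAlgType K) (s : lieSub g)
    (V : vectType K) (rho : subvs_of s -> 'End(V)) (Z P : {vspace g}) : Prop := {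
  gkin_rep : is_rep rho;
  gkin_faithful : faithful_rep rho;
  gkin_simple : absolutely_simple rho;
  gkin_isotypic : forall w,
    weak_isotypic rho (tens2_rep rho) (exterior2 V) w -> w = 0;
  gkin_form : exists2 B, scalar_product B & invariant_form rho B;
  gkin_sum : (Z + s + P)%VS = fullv;
  gkin_direct : directv (Z + s + P);
  gkin_P : iso_submodule (sum_rep rho rho) (@ad_sub K g s) P;
  gkin_Z_line : \dim Z = 1%N;
  gkin_Z_central : {in Z & s, forall z x, [lie z, x] = 0}
}.

Definition associated_involution (K : fieldType) (g : lieAlgType K)
    (s Z P : {vspace g}) (sigma : involution g) : Prop :=
  {in (Z + s)%VS, forall x, sigma x = x} /\ {in P, forall x, sigma x = - x}.

Section Endomorphisms.
Context {K : fieldType} {V : vectType K}.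
Implicit Types (f : 'End(V)) (U W : {vspace V}).

(* For an [f]-stable subspace [U]. *)
Definition nilpotent_on f U : Prop :=
  exists n : nat, {in U, forall u, iter n f u = 0}.

Definition semisimple_on f U : Prop :=
  forall W, (W <= U)%VS -> (f @: W <= W)%VS ->
    exists W', [/\ (f @: W' <= W')%VS, (W + W')%VS = U & (W :&: W' = 0)%VS].

End Endomorphisms.

(* Main.v *)
(* Absolute simplicity of V turns the s-endomorphism ad z of P = V + V into a
   2x2 scalar matrix, so ad z has a quadratic annihilating polynomial
   (X - a)(X - b) on P. If a <> b it is semisimple; if a = b = 0 it squares to
   zero. If a = b <> 0, then [P, P] lies in Z + s, which z centralizes, so the
   bracket of P is killed by the derivation ad z, whose only generalized
   eigenvalue on the exterior square of P is 2a <> 0: hence [P, P] = 0 and the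
   symmetric space is flat. *)
Require Import Defs.
From HB Require Import structures.
From mathcomp Require Import all_boot all_algebra.
From mathcomp Require Import reals complex ring.

Set Implicit Arguments.
Unset Strict Implicit.
Unset Printing Implicit Defensive.

Import GRing.Theory Num.Theory.
Local Open Scope ring_scope.

(** * Endomorphisms killed on a subspace by a product of two linear factors *)

Section QuadraticEndomorphism.
Context {K : fieldType} {V : vectType K}.
Implicit Types (f : 'End(V)) (U W : {vspace V}) (a b : K).

(** Expanded form of [(f - a)(f - b) = 0] on [U]; recording the roots rather than the coefficients
    gives direct access to the eigenspaces. *)
Definition quadratic_on f U a b : Prop :=
  {in U, forall u, f (f u) = (a + b) *: f u - (a * b) *: u}.

Lemma quadratic_onC f U a b : quadratic_on f U a b -> quadratic_on f U b a.
Proof. by move=> quad u uU; rewrite (addrC b) (mulrC b) quad. Qed.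

Lemma quadratic_eigen f U a b u : quadratic_on f U a b -> u \in U ->
  f (f u - b *: u) = a *: (f u - b *: u).
Proof.
move=> quad uU; rewrite linearB linearZ /= quad //.
by rewrite scalerDl addrAC addrK scalerBr scalerA.
Qed.

Lemma iter_eigen f a u n : f u = a *: u -> iter n f u = a ^+ n *: u.
Proof.
by move=> fu; elim: n => [|n IH]; rewrite ?scale1r //= IH linearZ /= fu scalerA exprSr.
Qed.

Lemma iter_eigen0 f a u n : f u = a *: u -> iter n f u = 0 -> a != 0 -> u = 0.
Proof.
move=> fu + a0; rewrite (iter_eigen n fu) => /eqP.
by rewrite scaler_eq0 expf_eq0 (negPf a0) andbF => /eqP.
Qed.

(** The relation does not determine the roots, so they may be nonzero; a nonzero one is discarded
    because a nilpotent map has no eigenvector with nonzero eigenvalue. *)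
Lemma quadratic_nilpotent f U a b :
  quadratic_on f U a b -> nilpotent_on f U -> {in U, forall u, f (f u) = 0}.
Proof.
move=> quad [n nil] u uU.
have iter_f x y c : iter n f (x - c *: y) = iter n f x - c *: iter n f y.
  elim: n {nil} => //= n ->; by rewrite linearB linearZ.
(* [U] is not assumed stable, so [nil] cannot be applied to [f u]; the extra [f] is moved outside
   the iterate instead. *)
have nilf : iter n f (f u) = 0 by rewrite -iterSr /= nil // linear0.
have eig : f (f u - b *: u) = a *: (f u - b *: u).
  exact: quadratic_eigen quad uU.
have [a0|a0] := eqVneq a 0.
  have fu : f (f u) = b *: f u by rewrite quad // a0 add0r mul0r scale0r subr0.
  have [b0|b0] := eqVneq b 0; first by rewrite fu b0 scale0r.
  by rewrite (iter_eigen0 fu nilf b0) linear0.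
have /eqP : f u - b *: u = 0.
  by apply: (iter_eigen0 (n := n) eig) => //; rewrite iter_f nilf nil // scaler0 subr0.
rewrite subr_eq0 => /eqP fu.
have [b0|b0] := eqVneq b 0; first by rewrite fu b0 scale0r linear0.
by rewrite fu (iter_eigen0 fu (nil _ uU) b0) scaler0 linear0.
Qed.

Definition eigen_in f U a : {vspace V} := (U :&: lker (f - a *: \1%VF))%VS.

Lemma eigen_inP f U a u : reflect (u \in U /\ f u = a *: u) (u \in eigen_in f U a).
Proof.
rewrite memv_cap memv_ker add_lfunE opp_lfunE scale_lfunE id_lfunE subr_eq0.
by apply: (iffP andP) => -[uU /eqP].
Qed.

Lemma eigen_in_eq0 f U a b u :
  a != b -> u \in eigen_in f U a -> u \in eigen_in f U b -> u = 0.
Proof.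
move=> ab /eigen_inP[_ fu] /eigen_inP[_ /eqP].
by rewrite fu -subr_eq0 -scalerBl scaler_eq0 subr_eq0 (negPf ab) => /eqP.
Qed.

Lemma eigen_in_stable f U a W : (W <= eigen_in f U a)%VS -> (f @: W <= W)%VS.
Proof.
move=> /subvP WE; apply/subvP => _ /memv_imgP[w wW ->].
by have /eigen_inP[_ fw] := WE w wW; rewrite fw rpredZ.
Qed.

(** The maps [(f - b) / (a - b)] and [(a - f) / (a - b)] sum to the identity, and by the quadratic
    relation they send [U] into the two eigenspaces. *)
Lemma eigen_in_decomp f U a b : a != b -> quadratic_on f U a b ->
  (f @: U <= U)%VS -> U = (eigen_in f U a + eigen_in f U b)%VS.
Proof.
move=> ab quad fU; apply/eqP; rewrite eqEsubv subv_add !capvSl !andbT.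
apply/subvP => u uU; have fuU : f u \in U.
  by apply: (subvP fU); apply: memv_img.
have ab0 : a - b != 0 by rewrite subr_eq0.
have -> : u = (a - b)^-1 *: (f u - b *: u) + (a - b)^-1 *: (a *: u - f u).
  by rewrite -scalerDr [X in _ *: X]addrC addrA subrK -scalerBl scalerK.
apply: memv_add; apply/eigen_inP; split; rewrite ?rpredZ ?rpredB ?rpredZ //.
  by rewrite linearZ /= (quadratic_eigen quad uU) !scalerA mulrC.
rewrite -[a *: u - _]opprB scalerN linearN linearZ /=.
by rewrite (quadratic_eigen (quadratic_onC quad) uU) scalerN !scalerA mulrC.
Qed.

(** A stable [W] inherits the relation, hence is the sum of its intersections with the two
    eigenspaces. Each is complemented inside the eigenspace, where every subspace is stable. *)
Lemma quadratic_semisimple f U a b : a != b -> quadratic_on f U a b ->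
  (f @: U <= U)%VS -> semisimple_on f U.
Proof.
move=> ab quad fU W WU fW.
have subE c : (eigen_in f W c <= eigen_in f U c)%VS by rewrite capvS.
have WE : W = (eigen_in f W a + eigen_in f W b)%VS.
  by apply: eigen_in_decomp => // w /(subvP WU); apply: quad.
pose C c := (eigen_in f U c :\: eigen_in f W c)%VS.
have CE c : (C c <= eigen_in f U c)%VS by apply: diffvSl.
have CW c : (C c + eigen_in f W c)%VS = eigen_in f U c.
  by rewrite addv_diff; apply/addv_idPl.
exists (C a + C b)%VS; split.
- by rewrite limgD addvS // (eigen_in_stable (CE _)).
- rewrite [in LHS]WE [in LHS]addvC -addvA [(eigen_in f W a + _)%VS]addvC.
  rewrite [(C b + _)%VS]addvA CW [(_ + eigen_in f W a)%VS]addvC addvA CW.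
  exact/esym/eigen_in_decomp.
apply/eqP; rewrite -subv0; apply/subvP => w /memv_capP[+ ].
rewrite [in X in X -> _]WE.
move=> /memv_addP[wa waW [wb wbW ->]] /memv_addP[ca caC [cb cbC eqw]].
have C0 c x : x \in eigen_in f W c -> x \in C c -> x = 0.
  move=> xW xC; apply/eqP; rewrite -memv0 -(capv_diff (eigen_in f U c) (eigen_in f W c)).
  by rewrite memv_cap xC.
have waU := subvP (subE a) _ waW; have wbU := subvP (subE b) _ wbW.
have caU := subvP (CE a) _ caC; have cbU := subvP (CE b) _ cbC.
(* Sorting [eqw] by eigenvalue gives a vector lying in both eigenspaces, hence zero. *)
have eqab : wa - ca = cb - wb.
  by apply/eqP; rewrite subr_eq addrAC eq_sym subr_eq addrC -eqw.
have ab0 : wa - ca = 0.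
  by apply: (eigen_in_eq0 (f := f) (U := U) ab); [|rewrite eqab]; rewrite rpredB.
have wa0 : wa = 0 by apply: (C0 a) => //; rewrite (subr0_eq ab0).
have wb0 : wb = 0 by apply: (C0 b) => //; rewrite -(subr0_eq (etrans (esym eqab) ab0)).
by rewrite wa0 wb0 addr0 mem0v.
Qed.

End QuadraticEndomorphism.

(** * Commutant of the sum of two copies of an absolutely simple module *)

Section SumRepresentation.
Context {K : fieldType} {S : lieAlgType K} {V : vectType K}.
Variable rho : S -> 'End(V).
Hypothesis rho_simple : absolutely_simple rho.

(** Absolute simplicity for bare functions, the form in which the blocks of an endomorphism of
    [V * V] arise. *)
Lemma absolutely_simple_linear (h : V -> V) : linear h ->
  (forall x v, h (rho x v) = rho x (h v)) -> exists c, forall v, h v = c *: v.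
Proof.
move=> h_lin hC; pose H := GRing.isLinear.Build _ _ _ _ h h_lin.
have hE v : linfun h v = h v by exact: (lfunE (HB.pack h H : {linear _ -> _})).
have [|c cE] := rho_simple.2 (linfun h); first by move=> x v; rewrite !hE hC.
by exists c => v; rewrite -hE.
Qed.

(* Cayley-Hamilton for the 2x2 matrix [[a, b], [c, d]] of [h]. *)
Lemma sum_rep_quadratic (h : (V * V)%type -> (V * V)%type) : linear h ->
  (forall x p, h (sum_rep rho rho x p) = sum_rep rho rho x (h p)) ->
  exists t d : K, forall p, h (h p) = t *: h p - d *: p.
Proof.
move=> h_lin hC.
have hl k u v : h (k *: u + v, 0) = k *: h (u, 0) + h (v, 0).
  by rewrite -h_lin; congr h; congr (_, _); rewrite /= scaler0 addr0.
have hr k u v : h (0, k *: u + v) = k *: h (0, u) + h (0, v).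
  by rewrite -h_lin; congr h; congr (_, _); rewrite /= scaler0 addr0.
have hCl x v : h (rho x v, 0) = (rho x (h (v, 0)).1, rho x (h (v, 0)).2).
  by rewrite -sum_repE -hC sum_repE /= linear0.
have hCr x v : h (0, rho x v) = (rho x (h (0, v)).1, rho x (h (0, v)).2).
  by rewrite -sum_repE -hC sum_repE /= linear0.
(* Each of the four blocks of [h] commutes with [rho], so it is a scalar. *)
have [|x v|a aE] := @absolutely_simple_linear (fun v => (h (v, 0)).1).
- by move=> k u v; rewrite hl.
- by rewrite hCl.
have [|x v|c cE] := @absolutely_simple_linear (fun v => (h (v, 0)).2).
- by move=> k u v; rewrite hl.
- by rewrite hCl.
have [|x v|b bE] := @absolutely_simple_linear (fun v => (h (0, v)).1).
- by move=> k u v; rewrite hr.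
- by rewrite hCr.
have [|x v|d dE] := @absolutely_simple_linear (fun v => (h (0, v)).2).
- by move=> k u v; rewrite hr.
- by rewrite hCr.
have hE p : h p = (a *: p.1 + b *: p.2, c *: p.1 + d *: p.2).
  case: p => u v /=; have -> : (u, v) = 1 *: (u, 0) + (0, v) :> (V * V)%type.
    by rewrite scale1r; congr (_, _); rewrite /= ?addr0 ?add0r.
  rewrite h_lin scale1r.
  have /= := (aE u, cE u, bE v, dE v); case: (h (u, 0)) => ? ?; case: (h (0, v)) => ? ? /=.
  by move=> [[[-> ->] ->] ->].
(* Trace and determinant of the block matrix. *)
exists (a + d), (a * d - b * c) => p; rewrite !hE /=; congr (_, _) => /=;
  rewrite !scalerDr !scalerA addrACA -!scalerDl.
  by rewrite addrAC -scalerBl; congr (_ *: _ + _ *: _); ring.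
by rewrite -addrA -scalerBl; congr (_ *: _ + _ *: _); ring.
Qed.

End SumRepresentation.

Lemma monic_quadratic_factor (F : closedFieldType) (t d : F) :
  exists a b : F, t = a + b /\ d = a * b.
Proof.
(* The equation solved is [a ^+ 2 = t * a - d], whence the signs; the roots sum to [t], so the other
   one is [t - a]. *)
have [a aE] := @solve_monicpoly F 2 (fun i => if i == 0 then - d else t) isT.
exists a, (t - a); split; first by rewrite addrC subrK.
move: aE; rewrite !big_ord_recr big_ord0 /= add0r expr0 mulr1 expr1 => aE.
by rewrite mulrBr -expr2 aE; ring.
Qed.

(** * The action of [Z] on [P] *)

Section GenericKinematical.
Context {K : fieldType} {g : lieAlgType K} {s : lieSub g} {V : vectType K}.
Variables (rho : subvs_of s -> 'End(V)) (Z P : {vspace g}) (sigma : involution g).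
Hypothesis gkin : generic_kinematical rho Z P.
Hypothesis assoc : associated_involution s Z P sigma.
Hypothesis two_neq0 : 2%:R != 0 :> K.

Lemma kinematical_decomp x :
  exists h p, [/\ h \in (Z + s)%VS, p \in P & x = h + p].
Proof.
have : x \in (Z + s + P)%VS by rewrite (gkin_sum gkin) memvf.
by case/memv_addP=> h hH [p pP ->]; exists h, p.
Qed.

Lemma double_eq0 (x : g) : x = - x -> x = 0.
Proof.
move/eqP; rewrite -subr_eq0 opprK -mulr2n -scaler_nat scaler_eq0 (negPf two_neq0).
by move/eqP.
Qed.

(** The [Z + s] component [h] of a vector negated by [sigma] satisfies [h = - h], hence vanishes as
    2 is invertible. This lets [flat] be tested on [P]. *)
Lemma associated_minus_part : minus_part sigma = P.
Proof.
apply/vspaceP => x; apply/minus_partP/idP => [sx|]; last exact: assoc.2.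
have [h [p [hH pP xE]]] := kinematical_decomp x; move: sx.
rewrite xE linearD /= assoc.1 // assoc.2 // opprD => /addIr /double_eq0 ->.
by rewrite add0r.
Qed.

Lemma associated_fixed x : sigma x = x -> x \in (Z + s)%VS.
Proof.
have [h [p [hH pP ->]]] := kinematical_decomp x.
rewrite linearD /= assoc.1 // assoc.2 // => /addrI /esym /double_eq0 ->.
by rewrite addr0.
Qed.

(** [sigma] fixes [z] and negates [p], so it negates their bracket. *)
Lemma lie_ZP z p : z \in Z -> p \in P -> [lie z, p] \in P.
Proof.
move=> zZ pP; rewrite -associated_minus_part; apply/minus_partP.
rewrite invol_lie assoc.1 ?assoc.2 ?lieNr //.
by rewrite (subvP (addvSl _ _)).
Qed.

Lemma Z_line z0 z : z0 \in Z -> z0 != 0 -> z \in Z -> exists c, z = c *: z0.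
Proof.
move=> z0Z z0N zZ; apply/vlineP; suff -> : <[z0]>%VS = Z by [].
by apply/eqP; rewrite eqEdim -memvE z0Z (gkin_Z_line gkin) dim_vline z0N.
Qed.

Lemma lie_ZZ y z : y \in Z -> z \in Z -> [lie y, z] = 0.
Proof.
move=> yZ zZ; have [->|y0] := eqVneq y 0; first by rewrite lie0l.
by have [c ->] := Z_line yZ y0 zZ; rewrite linearZ /= liexx scaler0.
Qed.

(** By Leibniz the sum is [[z, [p, q]]]; since [sigma] fixes [[p, q]], it lies in [Z + s], which [z]
    centralizes. *)
Lemma lie_Z_PP z p q : z \in Z -> p \in P -> q \in P ->
  [lie [lie z, p], q] + [lie p, [lie z, q]] = 0.
Proof.
move=> zZ pP qP; rewrite -lie_leibniz.
have /memv_addP[y yZ [x xs ->]] : [lie p, q] \in (Z + s)%VS.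
  by apply: associated_fixed; rewrite invol_lie !assoc.2 // lieNl lieNr opprK.
by rewrite lieDr lie_ZZ // (gkin_Z_central gkin) // addr0.
Qed.

Lemma ad_Z_quadratic z : z \in Z ->
  exists t d : K, {in P, forall p, [lie z, [lie z, p]] = t *: [lie z, p] - d *: p}.
Proof.
move=> zZ; have [_ [f [f_inj fP fE]]] := gkin_P gkin.
have f0 : lker f == 0%VS by apply/lker0P.
have fK x : x \in P -> f ((f^-1)%VF x) = x by move=> xP; rewrite limg_lfunVK ?fP.
have fmem v : f v \in P by rewrite -fP memv_img ?memvf.
(* [f^-1] is a right inverse of [f] only on [P]; stability of [P] under [ad z] is what makes [h] the
   transport of [ad z] to [V * V]. *)
pose h v := (f^-1)%VF [lie z, f v].
have fh v : f (h v) = [lie z, f v] by rewrite fK // lie_ZP.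
have [||t [d hE]] := @sum_rep_quadratic _ _ _ rho (gkin_simple gkin) h.
- by move=> k u v; apply: f_inj; rewrite linearP /= !fh linearP /= linearP.
- move=> x v; apply: f_inj; rewrite fh !fE fh /ad_sub !adE lie_leibniz.
  by rewrite (gkin_Z_central gkin zZ (subvsP x)) lie0l add0r.
exists t, d => p pP; rewrite -(fK p pP); set v := (f^-1)%VF p.
by rewrite -!fh hE linearB !linearZ.
Qed.

(** Put [N = ad z - a], whose square vanishes on [P]. Then [[N p, q] + [p, N q] = - 2 a [p, q]], so
    a bracket vanishes once the left side does. This is applied in turn to the pairs [(N p, N q)],
    [(N p, q)] and [(p, q)]. *)
Lemma double_root_flat z a : z \in Z -> a != 0 ->
  quadratic_on (ad z) P a a -> flat sigma.
Proof.
move=> zZ a0 quad.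
pose N p := [lie z, p] - a *: p.
have NP p : p \in P -> N p \in P by move=> pP; rewrite rpredB ?rpredZ ?lie_ZP.
have NN p : p \in P -> N (N p) = 0.
  move=> pP; have := quadratic_eigen quad pP.
  by rewrite !adE -/(N p) /(N (N p)) => ->; rewrite subrr.
have a2 : - (2 * a) != 0 by rewrite oppr_eq0 mulf_neq0.
have NE p q : p \in P -> q \in P ->
    [lie N p, q] + [lie p, N q] = - (2 * a) *: [lie p, q].
  move=> pP qP; rewrite /N lieDl lieDr lieNl lieNr lieZl [[lie p, _ *: q]]linearZ /= addrACA.
  by rewrite lie_Z_PP // add0r -opprD -scalerDl scaleNr mulrDl mul1r.
have zero p q : p \in P -> q \in P -> [lie N p, q] + [lie p, N q] = 0 -> [lie p, q] = 0.
  by move=> pP qP; rewrite NE // => /eqP; rewrite scaler_eq0 (negPf a2) => /eqP.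
have zNN p q : p \in P -> q \in P -> [lie N p, N q] = 0.
  by move=> pP qP; apply: zero; rewrite ?NP // !NN // lie0l lie0r addr0.
have zN p q : p \in P -> q \in P -> [lie N p, q] = 0.
  by move=> pP qP; apply: zero; rewrite ?NP // NN // lie0l zNN // addr0.
rewrite /flat associated_minus_part; apply: lie_vs_sub => p q pP qP.
suff -> : [lie p, q] = 0 by apply: mem0v.
by apply: zero => //; rewrite zN // [X in _ + X]lieC zN // subr0.
Qed.

(** Carries the roots found for one generator of [Z] to the whole line. *)
Lemma quadratic_adZ (z : g) (c a b : K) :
  quadratic_on (ad z) P a b -> quadratic_on (ad (c *: z)) P (c * a) (c * b).
Proof.
move=> quad p pP; have := quad p pP; rewrite !adE !lieZl [[lie z, _ *: _]]linearZ /= => ->.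
by rewrite !scalerBr !scalerA; congr (_ *: _ - _ *: _); ring.
Qed.

End GenericKinematical.

(** * The dichotomy along the whole line [Z] *)

Theorem proposition3p1 (R : realType) (g : lieAlgType R[i]) (s : lieSub g)
    (V : vectType R[i]) (rho : subvs_of s -> 'End(V)) (Z P : {vspace g})
    (sigma : involution g) :
  generic_kinematical rho Z P ->
  associated_involution s Z P sigma ->
  indecomposable sigma ->
  ~ flat sigma ->
  ((forall z, z \in Z -> nilpotent_on (ad z) P) \/
   (forall z, z \in Z -> semisimple_on (ad z) P)) /\
  ((forall z, z \in Z -> nilpotent_on (ad z) P) ->
    forall z p, z \in Z -> p \in P -> [lie z, [lie z, p]] = 0).
Proof.
move=> gkin assoc _ nflat.
have two0 : 2%:R != 0 :> R[i] by rewrite pnatr_eq0.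
have stable z : z \in Z -> (ad z @: P <= P)%VS.
  move=> zZ; apply/subvP => _ /memv_imgP[p pP ->]; rewrite adE.
  exact: (lie_ZP gkin assoc two0).
have quadZ z : z \in Z -> exists a b, quadratic_on (ad z) P a b.
  move=> zZ; have [t [d tdE]] := ad_Z_quadratic gkin assoc two0 zZ.
  have [a [b [tE dE]]] := monic_quadratic_factor t d.
  by exists a, b => p pP; rewrite !adE tdE // tE dE.
split; last first.
  move=> nil z p zZ pP; have [a [b quad]] := quadZ z zZ.
  by have := quadratic_nilpotent quad (nil z zZ) pP; rewrite !adE.
(* The roots at one generator of the line decide the same alternative for every [z]. *)
have z0Z : vpick Z \in Z := memv_pick Z.
have z0N : vpick Z != 0 by rewrite vpick0 -dimv_eq0 (gkin_Z_line gkin).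
have [a [b quad]] := quadZ _ z0Z.
have [ab|ab] := eqVneq a b; last first.
  right=> z zZ; have [c zE] := Z_line gkin z0Z z0N zZ.
  (* For [c = 0] the scaled roots coincide, but the zero map also satisfies [X (X - 1) = 0], with
     distinct roots 0 and 1. *)
  have [c0|c0] := eqVneq c 0.
    apply: (@quadratic_semisimple _ _ _ _ 0 1 _ _ (stable z zZ)).
      by rewrite eq_sym oner_eq0.
    by move=> p _; rewrite !adE zE c0 scale0r !lie0l mul0r !(scaler0, scale0r) subr0.
  apply: (quadratic_semisimple _ _ (stable z zZ)); last by rewrite zE; apply: quadratic_adZ quad.
  by apply: contra_neq ab => /(mulfI c0).
subst b; have [a0|a0] := eqVneq a 0; last first.
  by case: nflat; apply: (double_root_flat gkin assoc two0 z0Z a0 quad).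
left=> z zZ; have [c zE] := Z_line gkin z0Z z0N zZ.
(* The double root is 0, so the quadratic relation itself says that the square vanishes. *)
exists 2 => p pP /=; rewrite zE (quadratic_adZ c quad pP) a0.
by rewrite !mulr0 addr0 !scale0r subr0.
Qed.
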